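(* Suppose that for some integer $m\ge 0$ the sequence $\left(\{d_n(-1)^m L_{n,m}\}\right)_{n\ge \max(1,m)}$ does not converge to $0$ as $n\to\infty$. Then Euler's constant $\gamma$ is irrational.
   Context: $\gamma=\lim_{n\to\infty}\left(\sum_{k=1}^n \frac1k-\ln n\right)$ is Euler's constant. $d_n:=\mathrm{LCM}(1,\ldots,n)$ is the least common multiple of the first $n$ positive integers. $\{x\}=x-\lfloor x\rfloor$ is the fractional part of the real number $x$. For integers $0\le m\le n$, $$L_{n,m}:=\sum_{k=0}^n\binom{n}{k}\binom{n+k}{k}(-1)^{n+k}\ln(n-m+k+1).$$ *)

(* Defs.v *)
From mathcomp Require Import all_boot all_order all_algebra.
From mathcomp Require Import all_classical all_reals all_analysis.

Set Implicit Arguments.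
Unset Strict Implicit.
Unset Printing Implicit Defensive.

Import Order.TTheory GRing.Theory Num.Theory.
Import numFieldNormedType.Exports.

Local Open Scope classical_set_scope.
Local Open Scope ring_scope.

Definition euler_gamma (R : realType) : R :=
  limn (fun n : nat => \sum_(1 <= k < n.+1) (k%:R : R)^-1 - ln (n%:R : R)).

Definition lcm_upto (n : nat) : nat := \big[lcmn/1%N]_(1 <= i < n.+1) i.

Definition frac_part (R : realType) (x : R) : R := x - (Num.floor x)%:~R.

(* Meant for m <= n: the argument of ln is a natural number, and the
   subtraction n - m is truncated when n < m. *)
Definition Lnm (R : realType) (n m : nat) : R :=
  \sum_(0 <= k < n.+1)
    'C(n, k)%:R * 'C(n + k, k)%:R * (-1) ^+ (n + k)
      * ln ((n - m + k + 1)%N%:R : R).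

(* Main.v *)
Require Import Defs.
From mathcomp Require Import all_boot all_order all_algebra.
From mathcomp Require Import all_classical all_reals all_analysis.
From mathcomp Require Import zify ring lra.

(** Let [c_k] be the coefficients of the shifted Legendre polynomial
    [P_n (2 x - 1)] and let [f x := 1 / ln x + 1 / (1 - x)], so that
    [int_0^1 x ^ N f = ln (N + 1) - H_N + gamma].  Since [sum c_k = 1], [L_(n,m)]
    is [sum c_k H_(n-m+k) - gamma + V] with [V := int_0^1 x ^ (n-m) P_n f].  By
    orthogonality [sum c_k H_(n-m+k) = sum c_k H_k], which [d_n] makes integral;
    so if [gamma] is rational, [d_n (-1) ^ m L_(n,m)] is eventually an integer
    plus [d_n (-1) ^ m V].

    The expansion [f x = sum_j mu_(j,0) (1 - x) ^ j] has the Gregory coefficients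
    as coefficients; they extend to a totally monotone array
    [mu_(a,b) = mu_(a+1,b) + mu_(a,b+1)] with nonnegative entries.  Summing
    [V = sum_j mu_(j,0) int x ^ (n-m) (1 - x) ^ j P_n] by parts [n - m] times
    leaves integrals [int (1 - x) ^ j P_n], all of sign [(-1) ^ n], against
    [mu_(j-n+m,n-m)]; hence [0 <= (-1) ^ m V <= 2 * 4 ^ (m-n)].

    Finally [d_N] divides [N! / ((N/2)! (N/3)! (N/6)!) * d_(N/6)] (integer
    quotients), whence [d_n = O((7/2) ^ n)], and [d_n (-1) ^ m V] tends to [0]
    through nonnegative values. *)

Set Implicit Arguments.
Unset Strict Implicit.
Unset Printing Implicit Defensive.

Import Order.TTheory GRing.Theory Num.Theory.
Import numFieldNormedType.Exports.

Local Open Scope classical_set_scope.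
Local Open Scope ring_scope.

(** * The growth of lcm(1, ..., n) *)

Section LcmBound.
Local Open Scope nat_scope.

Lemma lcm_uptoS n : lcm_upto n.+1 = lcmn (lcm_upto n) n.+1.
Proof. by rewrite /lcm_upto big_nat_recr. Qed.

Lemma dvdn_lcm_upto n i : 0 < i <= n -> i %| lcm_upto n.
Proof.
elim: n => [|n IHn] /andP[i0]; first by rewrite leqNgt i0.
rewrite lcm_uptoS leq_eqVlt => /predU1P[->|]; first exact: dvdn_lcmr.
by rewrite ltnS => iN; apply: dvdn_trans (dvdn_lcml _ _); rewrite IHn ?i0.
Qed.

Lemma lcm_upto_gt0 n : 0 < lcm_upto n.
Proof.
elim: n => [|n IHn]; first by rewrite /lcm_upto big_geq.
by rewrite lcm_uptoS lcmn_gt0 IHn.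
Qed.

(** The valuation is the largest [k] with [p ^ k <= n]; stating it as a count over [k] matches
    Legendre's formula for factorials. *)
Lemma logn_lcm_upto p n : prime p ->
  logn p (lcm_upto n) = \sum_(1 <= k < n.+1) (p ^ k <= n).
Proof.
move=> p_pr; have p1 := prime_gt1 p_pr.
case: n => [|n]; first by rewrite /lcm_upto !big_geq // logn1.
have -> : \sum_(1 <= k < n.+2) (p ^ k <= n.+1) = trunc_log p n.+1.
  set t := trunc_log p n.+1.
  have tn : t < n.+2.
    by rewrite (leq_trans (ltn_expl t p1))// leqW// trunc_logP.
  rewrite (big_cat_nat _ (n := t.+1)) //=.
  rewrite (eq_big_nat _ _ (F2 := fun=> 1)) => [|k /andP[_ kt]]; last first.
    by rewrite (leq_trans _ (trunc_logP p1 (ltn0Sn n))) // leq_exp2l.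
  rewrite sum_nat_const_nat subn1 muln1 big_nat_cond big1 ?addn0 // => k.
  rewrite andbT => /andP[tk _]; apply/eqP; rewrite eqb0 -ltnNge.
  by rewrite (leq_trans (trunc_log_ltn n.+1 p1)) // leq_exp2l.
apply/eqP; rewrite eqn_leq; apply/andP; split; last first.
  have := dvdn_leq_log p (lcm_upto_gt0 n.+1)
    (@dvdn_lcm_upto n.+1 (p ^ trunc_log p n.+1) _).
  by rewrite pfactorK //; apply; rewrite expn_gt0 prime_gt0 //= trunc_logP.
elim: n.+1 => [|k IHk]; first by rewrite /lcm_upto big_geq // logn1.
rewrite lcm_uptoS logn_lcm ?lcm_upto_gt0 // geq_max (leq_trans IHk) /=.
  by apply: trunc_log_max => //; rewrite dvdn_leq // pfactor_dvdnn.
by case: k {IHk} => [|k]; rewrite ?trunc_log0 // leq_trunc_log.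
Qed.

(** Valuations at each prime are compared term by term. With [y = N %/ p ^ k] the claim is [y >= 1]
    + y/2 + y/3 + y/6 <= y + [y >= 6] in integer quotients: a case check for y < 6, and a
    consequence of 1/2 + 1/3 + 1/6 = 1 from 6 on. *)
Lemma lcm_upto_dvd_fact N :
  lcm_upto N * ((N %/ 2)`! * (N %/ 3)`! * (N %/ 6)`!) %| N`! * lcm_upto (N %/ 6).
Proof.
have P0 := lcm_upto_gt0; have F0 := fact_gt0.
apply/dvdn_partP => [|p]; first by rewrite !muln_gt0 P0 !F0.
rewrite mem_primes => /andP[p_pr _].
rewrite p_part pfactor_dvdn ?muln_gt0 ?F0 ?P0 //.
rewrite !lognM ?muln_gt0 ?F0 ?P0 // !logn_lcm_upto // !logn_fact //.
have ext d (f : nat -> nat) : (forall k, N %/ d < k -> f k = 0) ->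
    \sum_(1 <= k < (N %/ d).+1) f k = \sum_(1 <= k < N.+1) f k.
  move=> f0; rewrite [RHS](big_cat_nat _ (n := (N %/ d).+1)) //= ?ltnS ?leq_div //.
  by rewrite [X in _ + X]big_nat_cond [X in _ + X]big1 ?addn0 // => k;
    rewrite andbT => /andP[/f0].
have kp k : k < p ^ k by rewrite ltn_expl ?prime_gt1.
do ![rewrite ext; last first].
all: try by move=> k dk; rewrite divn_small // (ltn_trans dk).
  by move=> k dk; apply/eqP; rewrite eqb0 -ltnNge (ltn_trans dk).
rewrite -!big_split; apply: leq_sum => k _ /=.
rewrite (divnAC N 2) (divnAC N 3) (divnAC N 6).
have pk : 0 < p ^ k by rewrite expn_gt0 prime_gt0.
have -> : (p ^ k <= N) = (0 < N %/ p ^ k) by rewrite divn_gt0.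
have -> : (p ^ k <= N %/ 6) = (5 < N %/ p ^ k).
  by rewrite leq_divRL // leq_divRL // mulnC.
move: (N %/ p ^ k) => y.
have [y6|] := leqP 6 y; last by do 6?[case: y => // y].
rewrite (leq_trans _ y6) //; lia.
Qed.

Lemma bin_mul_expn_le a b x y : 'C(a + b, b) * (x ^ a * y ^ b) <= (x + y) ^ (a + b).
Proof.
have hb : b < (a + b).+1 by rewrite ltnS leq_addl.
rewrite expnDn (bigD1 (Ordinal hb)) //= addnK mulnA.
by rewrite leq_addr.
Qed.

(** One term of the expansion of (1/2 + 1/3 + 1/6)^(a+b+c) = 1 is at most 1; obtained from two
    binomial bounds, with weights 1, 1 and then 2, 1. *)
Lemma multinomial_le a b c :
  (a + b + c)`! <= 2 ^ (a + c) * 3 ^ (b + c) * (a`! * b`! * c`!).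
Proof.
have h1 : 'C(a + (b + c), b + c) <= 2 ^ (a + (b + c)).
  by have := bin_mul_expn_le a (b + c) 1 1; rewrite !exp1n !muln1.
have h2 : 'C(b + c, c) * 2 ^ b <= 3 ^ (b + c).
  by have := bin_mul_expn_le b c 2 1; rewrite !exp1n !muln1.
have e1 : 'C(a + (b + c), b + c) * ((b + c)`! * a`!) = (a + (b + c))`!.
  by have := bin_fact (leq_addl a (b + c)); rewrite addnK.
have e2 : 'C(b + c, c) * (c`! * b`!) = (b + c)`!.
  by have := bin_fact (leq_addl b c); rewrite addnK.
rewrite -(leq_pmul2r (expn_gt0 2 b : 0 < 2 ^ b)).
rewrite -addnA -e1 -e2.
have := leq_mul h1 h2; rewrite !expnD.
set x := 'C(_, _); set y := 'C(_, _) => h.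
have -> : x * (y * (c`! * b`!) * a`!) * 2 ^ b = (x * (y * 2 ^ b)) * (a`! * b`! * c`!).
  by rewrite !mulnA; lia.
rewrite (leq_trans (leq_mul h (leqnn _))) //.
nia.
Qed.

(** Sixth powers clear denominators: 6 (a + c) <= 4 N, 6 (b + c) <= 3 N and 432 = 2^4 3^3. Rounding
    down loses at most 2 in a + b + c, which costs the factor N^2 before the sixth power. *)
Lemma lcm_upto_rec N : 0 < N ->
  lcm_upto N ^ 6 <= N ^ 12 * 432 ^ N * lcm_upto (N %/ 6) ^ 6.
Proof.
move=> N0; set a := N %/ 2; set b := N %/ 3; set c := N %/ 6.
have fN : N`! <= N ^ 2 * (a + b + c)`!.
  have [e|[e|e]] : N = a + b + c \/ N = (a + b + c).+1 \/ N = (a + b + c).+2.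
  - by rewrite /a /b /c; lia.
  - by rewrite -e leq_pmull // expn_gt0 N0.
  - rewrite {1}e factS -e leq_mul2r; apply/orP; right.
    by rewrite expnS leq_pmulr // expn_gt0 N0.
  - rewrite {1}e !factS -e mulnA leq_mul2r; apply/orP; right.
    by rewrite expnS expn1 leq_mul2l; apply/orP; right; rewrite -ltnS -e leqnSn.
have D : lcm_upto N <= N ^ 2 * (2 ^ (a + c) * 3 ^ (b + c)) * lcm_upto c.
  have F0 : 0 < a`! * b`! * c`! by rewrite !muln_gt0 !fact_gt0.
  rewrite -(leq_pmul2r F0).
  have := dvdn_leq _ (lcm_upto_dvd_fact N).
  rewrite muln_gt0 fact_gt0 lcm_upto_gt0 => /(_ isT) /leq_trans; apply.
  have := leq_trans fN (leq_mul (leqnn (N ^ 2)) (multinomial_le a b c)).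
  rewrite -/c; move: (lcm_upto c) => l.
  move=> /(fun h => leq_mul h (leqnn l)) /leq_trans; apply.
  by rewrite eq_leq //; lia.
move: D; rewrite -(leq_exp2r _ _ (isT : 0 < 6)) => /leq_trans; apply.
rewrite !expnMn -!expnM; apply: leq_mul => //; apply: leq_mul; first by rewrite -expnD.
have -> : 432 = 2 ^ 4 * 3 ^ 3 by [].
rewrite expnMn -!expnM.
by apply: leq_mul; rewrite leq_exp2l //; rewrite /a /b /c; lia.
Qed.

End LcmBound.

(** * Legendre sums of Beta integrals *)

Section FiniteDifference.
Variable R : comPzRingType.
Implicit Types (F G : nat -> R) (n x : nat).

Fixpoint fdiff n F x : R :=
  if n is n'.+1 then fdiff n' F x - fdiff n' F x.+1 else F x.

Lemma eq_fdiff n F G x : F =1 G -> fdiff n F x = fdiff n G x.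
Proof. by move=> FG; elim: n x => [|n IHn] x /=; rewrite ?FG // !IHn. Qed.

Lemma fdiffZ n c F x : fdiff n (fun k => c * F k) x = c * fdiff n F x.
Proof. by elim: n x => [|n IHn] x //=; rewrite !IHn mulrBr. Qed.

Lemma fdiff_shift n F x y : fdiff n (fun k => F (x + k)%N) y = fdiff n F (x + y).
Proof. by elim: n y => [|n IHn] y //=; rewrite !IHn addnS. Qed.

Lemma fdiffSr n F x : fdiff n.+1 F x = fdiff n (fun k => F k - F k.+1) x.
Proof. by elim: n x => [|n IHn] x //; rewrite [LHS]/= -!/(fdiff n.+1 F _) !IHn. Qed.

Lemma fdiffE n F x :
  fdiff n F x = \sum_(0 <= k < n.+1) (-1) ^+ k * 'C(n, k)%:R * F (x + k)%N.
Proof.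
elim: n x => [|n IHn] x; first by rewrite /= big_nat1 addn0 expr0 !mul1r.
rewrite /= !IHn [RHS]big_nat_recl // bin0 [in LHS]big_nat_recl // bin0 -addrA.
congr (_ + _).
rewrite [in X in _ - X]big_nat_recr //= binn [in RHS]big_nat_recr //= binn.
rewrite (eq_big_nat _ _ (F1 := fun i => _ * 'C(n.+1, _)%:R * _)
  (F2 := fun i => (-1) ^+ i.+1 * 'C(n, i.+1)%:R * F (x + i.+1)%N
         - (-1) ^+ i * 'C(n, i)%:R * F (x.+1 + i)%N)) => [|i _]; last first.
  by rewrite binS natrD exprS addnS addSn; ring.
rewrite sumrB exprS addSn addnS; ring.
Qed.

(** By Pascal's rule each difference lowers [r] by one and changes the sign, so [n] differences
    annihilate binomials of degree below [n]. *)
Lemma fdiff_bin n r x :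
  fdiff n (fun k => 'C(k, r)%:R) x =
  if (n <= r)%N then (-1) ^+ n * 'C(x, r - n)%:R else 0.
Proof.
elim: n r => [|n IHn] r; first by rewrite subn0 expr0 mul1r.
rewrite fdiffSr; case: r => [|r].
  rewrite (@eq_fdiff _ _ (fun k => 0 * 0)) ?fdiffZ ?mul0r // => k.
  by rewrite !bin0 subrr.
rewrite (@eq_fdiff _ _ (fun k => -1 * 'C(k, r)%:R)) => [|k].
  by rewrite fdiffZ IHn subSS ltnS exprS; case: ifP; rewrite ?mulr0 ?mulrA.
by rewrite binS natrD; ring.
Qed.

End FiniteDifference.

Section LegendreSums.
Variable R : realFieldType.
Implicit Types (n m a b i j k x N : nat).

(* The Beta integral of [x ^ N * (1 - x) ^ j] over [0, 1]. *)
Definition beta N j : R := N`!%:R * j`!%:R / (N + j).+1`!%:R.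

Lemma fact_neq0 n : n`!%:R != 0 :> R.
Proof. by rewrite pnatr_eq0 -lt0n fact_gt0. Qed.

Lemma beta_ge0 N j : 0 <= beta N j.
Proof. by rewrite !mulr_ge0 // invr_ge0. Qed.

Lemma betaC N j : beta N j = beta j N.
Proof. by rewrite /beta addnC [N`!%:R * _]mulrC. Qed.

Lemma betaN0 N : beta N 0 = N.+1%:R^-1.
Proof.
have h := fact_neq0 N; rewrite /beta addn0 factS (natrM _ N.+1) fact0.
by rewrite mulr1 invfM mulrCA divff ?mulr1.
Qed.

Lemma betaD N j : beta N j = beta N.+1 j + beta N j.+1.
Proof.
rewrite /beta addSn addnS !(factS (N + j).+1) (factS N) (factS j).
rewrite (natrM _ (N + j).+2) (natrM _ N.+1) (natrM _ j.+1).
have := fact_neq0 (N + j).+1; have : (N + j).+2%:R != 0 :> R by rewrite pnatr_eq0.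
have -> : (N + j).+2%:R = N.+1%:R + j.+1%:R :> R by rewrite -natrD addSn addnS.
move: N.+1%:R j.+1%:R (N + j).+1`!%:R => x y z h1 h2.
by field; rewrite h1 h2.
Qed.

Lemma beta_le N j : beta N j <= N.+1%:R^-1.
Proof.
elim: j => [|j]; first by rewrite betaN0.
by apply: le_trans; rewrite [leRHS]betaD lerDr beta_ge0.
Qed.

(** Each difference in the exponent of x multiplies the integrand by 1 - x. *)
Lemma fdiff_beta n x j : fdiff n (beta^~ j) x = beta x (j + n).
Proof.
elim: n x => [|n IHn] x /=; first by rewrite addn0.
by rewrite !IHn addnS [beta x (j + n)]betaD addrC addKr.
Qed.

(* The coefficients of the shifted Legendre polynomial [P_n (2 x - 1)]. *)
Definition legendre_coef n k : R := 'C(n, k)%:R * 'C(n + k, k)%:R * (-1) ^+ (n + k).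

Lemma sum_legendre_coef n F :
  \sum_(0 <= k < n.+1) legendre_coef n k * F k =
  (-1) ^+ n * fdiff n (fun k => 'C(n + k, n)%:R * F k) 0.
Proof.
rewrite fdiffE big_distrr; apply: eq_bigr => k _ /=.
have -> : 'C(n + k, n) = 'C(n + k, k) by rewrite -[in RHS]bin_sub ?leq_addl // addnK.
by rewrite /legendre_coef exprD add0n; ring.
Qed.

(** This is the value of P_n(2x - 1) at x = 1. *)
Lemma sum_legendre_coef1 n : \sum_(0 <= k < n.+1) legendre_coef n k = 1.
Proof.
under eq_bigr do rewrite -[legendre_coef _ _]mulr1.
rewrite sum_legendre_coef.
under eq_fdiff do rewrite mulr1.
rewrite (fdiff_shift _ (fun k => 'C(k, n)%:R)) fdiff_bin leqnn subnn bin0 mulr1.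
by rewrite -expr2 sqrr_sign.
Qed.

(** The integral of x^a (1 - x)^j P_n(2x - 1) over [0, 1]. *)
Definition legendre_beta n a j : R :=
  \sum_(0 <= k < n.+1) legendre_coef n k * beta (a + k) j.

Lemma legendre_betaS n a j :
  legendre_beta n a.+1 j = legendre_beta n a j - legendre_beta n a j.+1.
Proof.
rewrite /legendre_beta -sumrB; apply: eq_bigr => k _.
by rewrite [beta (a + k) j]betaD addSn; ring.
Qed.

(** C(n+k, n) times [beta k j] is a constant times C(n+k, n-j-1), of degree below n in k, so its
    n-th difference vanishes. *)
Lemma legendre_beta0_small n j : (j < n)%N -> legendre_beta n 0 j = 0.
Proof.
move=> jn; rewrite /legendre_beta (sum_legendre_coef n (fun k => beta (0 + k) j)).
set r := (n - j.+1)%N.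
rewrite (@eq_fdiff _ _ _ (fun k => j`!%:R * r`!%:R / n`!%:R * 'C(n + k, r)%:R)).
  rewrite fdiffZ (fdiff_shift _ (fun k => 'C(k, r)%:R)) fdiff_bin.
  by rewrite ifF ?mulr0 // /r; apply/negbTE; rewrite -ltnNge; lia.
move=> k; rewrite /beta add0n.
have e1 := bin_fact (leq_addr k n); rewrite addKn in e1.
have rk : (r <= n + k)%N by rewrite /r; lia.
have e2 := bin_fact rk.
have e3 : (n + k - r = (k + j).+1)%N by rewrite /r; lia.
rewrite e3 in e2; have {}e2 := etrans e1 (esym e2).
move/(congr1 (fun x => x%:R : R)): e2.
rewrite (natrM _ 'C(n + k, n)) (natrM _ 'C(n + k, r)) (natrM _ n`!) (natrM _ r`!).
have h1 := fact_neq0 n; have h2 := fact_neq0 (k + j).+1.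
move=> e2.
have alg (x y z t u v w : R) : z != 0 -> w != 0 ->
    x * (z * t) = y * (v * w) -> x * (t * u / w) = u * v / z * y.
  move=> z0 w0 e; apply: (mulIf w0); apply: (mulIf z0).
  transitivity (x * (z * t) * u); first by field.
  by rewrite e; field.
exact: alg.
Qed.

(** C(n+k, n) times [beta k (n + i)] is a constant times [beta (n + k) i], and the n-th difference
    of the latter is again a Beta integral. *)
Lemma legendre_beta0 n i :
  legendre_beta n 0 (n + i) =
  (-1) ^+ n * ((n + i)`!%:R ^+ 2 / (i`!%:R * (n + i + n).+1`!%:R)).
Proof.
rewrite /legendre_beta (sum_legendre_coef n (fun k => beta (0 + k) (n + i))).
congr (_ * _).
rewrite (@eq_fdiff _ _ _
  (fun k => (n + i)`!%:R / (n`!%:R * i`!%:R) * beta (n + k) i)).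
  rewrite fdiffZ (fdiff_shift _ (beta^~ i)) fdiff_beta /beta addn0.
  rewrite (addnC i n) (addnC (n + i) n).
  have h1 := fact_neq0 n; have h2 := fact_neq0 i.
  by have h3 := fact_neq0 (n + (n + i)).+1; field; rewrite ?h1 ?h2 ?h3.
move=> k; rewrite /beta add0n addnA (addnC k n).
have e1 := bin_fact (leq_addr k n); rewrite addKn in e1.
rewrite -e1 (natrM _ 'C(n + k, n)) (natrM _ n`!).
have := fact_neq0 n; have := fact_neq0 i; have := fact_neq0 (n + k + i).+1.
move: (_.+1`!%:R) (n`!%:R) (i`!%:R) => x y z h1 h2 h3.
by field; rewrite h1 h2 h3.
Qed.

Lemma legendre_beta_eq0 n a j : (a + j < n)%N -> legendre_beta n a j = 0.
Proof.
elim: a j => [|a IHa] j h; first exact: legendre_beta0_small.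
by rewrite legendre_betaS !IHa ?subrr //; lia.
Qed.

Definition harmonic_number N : R := \sum_(1 <= i < N.+1) i%:R^-1.

Lemma harmonic_numberS N : harmonic_number N.+1 = harmonic_number N + N.+1%:R^-1.
Proof. by rewrite /harmonic_number big_nat_recr. Qed.

(* Orthogonality of the Legendre polynomials to lower degrees. *)
Lemma legendre_harmonic n a : (a <= n)%N ->
  \sum_(0 <= k < n.+1) legendre_coef n k * harmonic_number (a + k) =
  \sum_(0 <= k < n.+1) legendre_coef n k * harmonic_number k.
Proof.
elim: a => [|a IHa] an; first by apply: eq_bigr.
rewrite -(IHa (ltnW an)); under eq_bigr do rewrite addSn harmonic_numberS mulrDr -betaN0.
rewrite big_split /= -[X in _ + X]/(legendre_beta n a 0) legendre_beta_eq0 ?addr0 //.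
by rewrite addn0.
Qed.

Lemma fact_ratio_le n j a : (n <= j)%N -> ((n + a)`! * j`! <= n`! * (j + a)`!)%N.
Proof.
move=> nj; elim: a => [|a IHa]; first by rewrite !addn0 leqnn.
rewrite !addnS !factS -mulnA (mulnCA n`!).
by apply: leq_mul => //; rewrite ltnS leq_add2r.
Qed.

Lemma fact_le_expn l d j : (l + d <= j)%N -> ((l + d)`! <= l`! * j ^ d)%N.
Proof.
elim: d => [|d IHd] h; first by rewrite addn0 muln1.
rewrite addnS factS expnS mulnCA; apply: leq_mul; first by rewrite -addnS.
by apply: IHd; lia.
Qed.

Lemma fact_ge_expn l d j : (j <= l)%N -> (l`! * j ^ d <= (l + d)`!)%N.
Proof.
move=> h; elim: d => [|d IHd]; first by rewrite addn0 muln1.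
by rewrite addnS factS expnS mulnCA; apply: leq_mul => //; lia.
Qed.

Lemma central_bin_ge a : (0 < a)%N -> (4 ^ a <= 2 * a * 'C(a + a, a))%N.
Proof.
elim: a => // -[|b] IHb _; first by [].
move: b.+1 IHb (isT : 0 < b.+1)%N => {}b /[apply] IHb.
have e1 := mul_bin_diag (b + b).+2 b.
have e2 := mul_bin_diag (b + b).+1 b.
have e3 : 'C((b + b).+1, b.+1) = 'C((b + b).+1, b).
  by rewrite -bin_sub; [congr 'C(_, _); lia | lia].
rewrite /= e3 in e1 e2; rewrite expnS addSn addnS.
move: 'C(b + b, b) 'C(_, b) 'C(_, _) IHb e1 e2 => x y z.
move: (4 ^ b)%N => f; nia.
Qed.

(** The intermediate bound is C(a-1+i, i) / (a C(n+a, a)), and a C(n+a, a) >= a C(2a, a) >= 4^a / 2.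
    The binomial weight in [i] is the one that [sum_bin_mu] can sum. *)
Lemma legendre_beta_bound n a i : (0 < a <= n)%N ->
  `|legendre_beta n 0 (i + a)| <= 2 / 4 ^+ a * 'C(a.-1 + i, i)%:R.
Proof.
case: a => // a /= an.
have [ia|ia] := ltnP (i + a.+1) n.
  by rewrite legendre_beta0_small // normr0 !mulr_ge0 // invr_ge0 exprn_ge0.
set j := (i + a.+1)%N in ia *; set l := (j - n)%N.
have jE : j = (n + l)%N by rewrite /l; lia.
rewrite {1}jE legendre_beta0 -jE normrM normrX normrN1 expr1n mul1r.
rewrite ger0_norm; last by rewrite mulr_ge0 ?exprn_ge0 // invr_ge0 mulr_ge0.
apply: (@le_trans _ _ ((n`! * a`!)%:R / (n + a.+1)`!%:R * 'C(a + i, i)%:R)); last first.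
  apply: ler_wpM2r => //.
  rewrite ler_pdivrMr ?ltr0n ?fact_gt0 // mulrAC ler_pdivlMr ?exprn_gt0 //.
  rewrite -natrX -!natrM ler_nat.
  have := bin_fact (leq_addl n a.+1); rewrite addnK => <-.
  have h : ('C(a.+1 + a.+1, a.+1) <= 'C(n + a.+1, a.+1))%N by rewrite leq_bin2l // leq_add2r.
  have := @central_bin_ge a.+1 isT; rewrite factS.
  move: ('C(_, _)) ('C(_, _)) h => x y xy h4.
  have {}h4 := leq_trans h4 (leq_mul (leqnn (2 * a.+1)%N) xy).
  have := leq_mul (leqnn (n`! * a`!)%N) h4; move: (4 ^ _)%N => z.
  move=> /leq_trans; apply; apply: eq_leq; ring.
have e := bin_fact (leq_addl a i); rewrite addnK in e.
have ji : (j = (a + i).+1)%N by rewrite /j; lia.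
rewrite ler_pdivrMr ?mulr_gt0 ?ltr0n ?fact_gt0 //.
rewrite -[leRHS]mulrA [leRHS]mulrAC ler_pdivlMr ?ltr0n ?fact_gt0 //.
rewrite -natrX -!natrM ler_nat.
have F0 : (0 < i`!)%N by apply: fact_gt0.
(* Both sides are multiplied by [i!] and [j!] so that powers of [j] cancel: [h1] costs [n - a.+1] of
   them, [ej] extracts one more from [j!], and [h3] absorbs them all. *)
rewrite -(leq_pmul2r F0).
have j0 : (0 < j)%N by rewrite ji.
have ed : (i = l + (n - a.+1))%N by rewrite /l /j; lia.
have h1 : (i`! <= l`! * j ^ (n - a.+1))%N by rewrite {1}ed fact_le_expn // -ed /j leq_addr.
have h2 := fact_ratio_le a.+1 ia.
have h3 : ((j + a.+1)`! * j ^ (n - a.+1).+1 <= (j + n).+1`!)%N.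
  have -> : ((j + n).+1 = j + a.+1 + (n - a.+1).+1)%N by lia.
  by rewrite fact_ge_expn // leq_addr.
have ej : (j`! = j * ('C(a + i, i) * (i`! * a`!)))%N by rewrite e ji factS.
have jf0 : (0 < j`!)%N by apply: fact_gt0.
have A0 : (0 < j ^ (n - a.+1))%N by rewrite expn_gt0 j0.
rewrite -(leq_pmul2r jf0).
move: h3; rewrite expnS; move: h1 h2 A0.
move: (j ^ _)%N => A h1 h2 A0 h3.
apply: (@leq_trans (j`! * (n`! * (j + a.+1)`!) * j`! * (l`! * A))%N).
  apply: (@leq_trans ((j`! * ((n + a.+1)`! * j`!) * j`!) * i`!)%N); first by apply: eq_leq; ring.
  by apply: leq_mul h1; rewrite leq_mul // leq_mul.
apply: (@leq_trans (j`! * ((j + a.+1)`! * (j * A)) * (n`! * l`!  * ('C(a + i, i) * (i`! * a`!))))%N).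
  by apply: eq_leq; rewrite {2}ej; ring.
apply: (@leq_trans (j`! * (j + n).+1`! * (n`! * l`!  * ('C(a + i, i) * (i`! * a`!))))%N).
  by apply: leq_mul => //; apply: leq_mul.
by apply: eq_leq; ring.
Qed.

End LegendreSums.

(** * Summation by parts against a totally monotone array *)

Section TotallyMonotone.
Variables (R : realFieldType) (mu : nat -> nat -> R).
Hypothesis mu_ge0 : forall a b, 0 <= mu a b.
Hypothesis muD : forall a b, mu a b = mu a.+1 b + mu a b.+1.
Hypothesis mu00 : mu 0 0 <= 1.

Lemma mu_le1 a b : mu a b <= 1.
Proof.
have mu0 b' : mu 0 b' <= 1.
  elim: b' => [//|b' IH]; apply: le_trans IH.
  by rewrite [leRHS]muD lerDr.
elim: a => [//|a IH]; apply: le_trans IH.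
by rewrite [leRHS]muD lerDl.
Qed.

(* Negative binomial law: for [mu a b] the integral of [t ^ a * (1 - t) ^ b],
   the full series would have sum [mu 0 0]. *)
Lemma sum_bin_mu b K : \sum_(0 <= k < K) 'C(b + k, k)%:R * mu k b.+1 <= mu 0 0.
Proof.
elim: b => [|b IHb].
  suff -> : \sum_(0 <= k < K) 'C(0 + k, k)%:R * mu k 1 = mu 0 0 - mu K 0.
    by rewrite gerBl.
  elim: K => [|K IHK]; first by rewrite big_geq // subrr.
  by rewrite big_nat_recr //= IHK binn mul1r [mu K 0]muD; ring.
suff : \sum_(0 <= k < K) 'C(b.+1 + k, k)%:R * mu k b.+2
    + 'C(b + K, K.-1)%:R * mu K b.+1 * (0 < K)%N%:R
    = \sum_(0 <= k < K) 'C(b + k, k)%:R * mu k b.+1.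
  move=> h; apply: le_trans IHb; rewrite -h.
  by rewrite lerDl !mulr_ge0.
elim: K {IHb} => [|K IHK]; first by rewrite !big_geq // mulr0 addr0.
rewrite !big_nat_recr //= -IHK addSn.
case: K {IHK} => [|K] /=; rewrite ?addn0 ?bin0 ?addnS.
  by rewrite [mu 0 b.+1]muD; ring.
by rewrite [mu K.+1 b.+1]muD (binS (b + K).+1) natrD; ring.
Qed.

(** The state after [b] summations by parts; with [b = 0] and the Gregory array it is a partial sum
    of the integral of x^a f P_n. *)
Definition legendre_sum n a b J : R :=
  \sum_(0 <= i < J) mu i b * legendre_beta R n a (i + b).

(** Summation by parts: a factor x = 1 - (1 - x) is traded for a difference of [mu] in its first
    index, which is [mu i b.+1]; the two ends leave boundary terms. *)
Lemma legendre_sumS n a b J : legendre_sum n a.+1 b J =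
  mu 0 b * legendre_beta R n a b - legendre_sum n a b.+1 J
  - mu J b * legendre_beta R n a (J + b).
Proof.
rewrite /legendre_sum; elim: J => [|J IHJ]; first by rewrite !big_geq // add0n; ring.
rewrite !big_nat_recr //= IHJ legendre_betaS [mu J b]muD addSn addnS; ring.
Qed.

Let S n : R := \sum_(0 <= k < n.+1) `|legendre_coef R n k|.

(** A crude bound, meant only to make the boundary terms at [J] vanish as [J] grows with [n]
    fixed. *)
Lemma legendre_beta_le n a j : `|legendre_beta R n a j| <= S n * j.+1%:R^-1.
Proof.
rewrite (le_trans (ler_norm_sum _ _ _)) // mulr_suml ler_sum // => k _.
by rewrite normrM ler_wpM2l // ger0_norm ?beta_ge0 // betaC beta_le.
Qed.

(** At each of the [a] steps the boundary term at 0 vanishes by orthogonality, and the one at [J]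
    contributes at most [S n / J.+1]. *)
Lemma legendre_sum_flip n a b J : (a + b <= n)%N ->
  `|legendre_sum n a b J - (-1) ^+ a * legendre_sum n 0 (a + b) J|
    <= a%:R * (S n * J.+1%:R^-1).
Proof.
elim: a b => [|a IHa] b abn; first by rewrite expr0 mul1r subrr normr0 mul0r.
rewrite legendre_sumS legendre_beta_eq0 // mulr0 sub0r addSnnS exprS.
rewrite [X in `|X|](_ : _ = - (mu J b * legendre_beta R n a (J + b)
  + (legendre_sum n a b.+1 J - (-1) ^+ a * legendre_sum n 0 (a + b.+1) J))); last by ring.
rewrite normrN mulrSr mulrDl mul1r [leRHS]addrC.
rewrite (le_trans (ler_normD _ _)) // lerD ?IHa //; last by rewrite -addSnnS.
rewrite normrM ger0_norm // -[leRHS]mul1r.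
apply: ler_pM => //; first exact: mu_le1.
rewrite (le_trans (legendre_beta_le _ _ _)) // ler_wpM2l ?sumr_ge0 //.
by rewrite lef_pV2 ?posrE ?ltr0n // ler_nat ltnS leq_addr.
Qed.

Lemma legendre_beta0_sign n j :
  legendre_beta R n 0 j = (-1) ^+ n * `|legendre_beta R n 0 j|.
Proof.
have [jn|nj] := ltnP j n; first by rewrite legendre_beta0_small // normr0 mulr0.
rewrite -(subnKC nj) legendre_beta0 normrM normrX normrN1 expr1n mul1r ger0_norm //.
Qed.

(** After the flip all terms have sign (-1)^n; [Q] is the sum of their absolute values, bounded by
    [legendre_beta_bound] and the negative binomial sum. *)
Lemma legendre_sum_bounds n a J : (0 < a <= n)%N ->
  - (a%:R * (S n * J.+1%:R^-1)) <= (-1) ^+ (n + a) * legendre_sum n a 0 J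
    <= 2 / 4 ^+ a + a%:R * (S n * J.+1%:R^-1).
Proof.
move=> an; set e := a%:R * _; have /andP[a0 a_n] := an.
set Q := \sum_(0 <= i < J) mu i a * `|legendre_beta R n 0 (i + a)|.
have Q0 : 0 <= Q by apply: sumr_ge0 => i _; rewrite mulr_ge0.
have QB : Q <= 2 / 4 ^+ a.
  apply: (@le_trans _ _
      (2 / 4 ^+ a * \sum_(0 <= k < J) 'C(a.-1 + k, k)%:R * mu k a.-1.+1)).
    rewrite big_distrr; apply: ler_sum => i _ /=.
    rewrite prednK // [X in _ <= X]mulrA [X in _ <= X]mulrC ler_wpM2l //.
    exact: legendre_beta_bound.
  rewrite -[leRHS]mulr1 ler_wpM2l ?mulr_ge0 ?invr_ge0 ?exprn_ge0 //.
  exact: le_trans (sum_bin_mu _ _) mu00.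
have PQ : legendre_sum n 0 a J = (-1) ^+ n * Q.
  rewrite /Q big_distrr; apply: eq_bigr => i _ /=.
  by rewrite {1}legendre_beta0_sign; ring.
have := @legendre_sum_flip n a 0 J; rewrite addn0 -/e => /(_ a_n).
rewrite PQ mulrA -exprD addnC; set s := (-1) ^+ _.
have ss : s * s = 1 by rewrite -expr2 sqrr_sign.
have s1 : `|s| = 1 by rewrite normrX normrN1 expr1n.
set P := legendre_sum n a 0 J.
have -> : `|P - s * Q| = `|s * P - Q|.
  by rewrite -[s * P - Q]mul1r -ss -mulrA mulrBr mulrA ss mul1r normrM s1 mul1r.
by rewrite ler_norml => /andP[h1 h2]; apply/andP; split; lra.
Qed.

End TotallyMonotone.

(** * Gregory coefficients *)

Section PolyIntegral.
Variable R : realType.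
Implicit Types (p q : {poly R}) (N a b i j J : nat).

(** The integral over [0, 1], read off the coefficients. *)
Definition poly_integ p : R := \sum_(i < size p) p`_i / i.+1%:R.

Lemma poly_integE n p : (size p <= n)%N -> poly_integ p = \sum_(i < n) p`_i / i.+1%:R.
Proof.
move=> pn; rewrite /poly_integ (big_ord_widen _ (fun i => p`_i / i.+1%:R) pn).
rewrite big_mkcond; apply: eq_bigr => i _; case: ltnP => // h.
by rewrite nth_default ?mul0r.
Qed.

Lemma poly_integD p q : poly_integ (p + q) = poly_integ p + poly_integ q.
Proof.
pose n := maxn (size p) (size q).
rewrite !(@poly_integE n) ?leq_maxl ?leq_maxr ?size_polyD // -big_split.
by apply: eq_bigr => i _; rewrite coefD mulrDl.
Qed.

Lemma poly_integZ c p : poly_integ (c *: p) = c * poly_integ p.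
Proof.
rewrite !(@poly_integE (size p)) ?size_scale_leq // big_distrr.
by apply: eq_bigr => i _; rewrite /= coefZ mulrA.
Qed.

Lemma poly_integ_sum J (F : nat -> {poly R}) :
  poly_integ (\sum_(0 <= j < J) F j) = \sum_(0 <= j < J) poly_integ (F j).
Proof.
elim: J => [|J IHJ]; last by rewrite !big_nat_recr //= poly_integD IHJ.
by rewrite !big_geq // /poly_integ size_poly0 big_ord0.
Qed.

(** The mean value theorem is applied to [F] minus the antiderivative [P] of [p]. *)
Lemma poly_integ_le p (F dF : R -> R) :
  (forall u : R, 0 <= u <= 1 -> is_derive u 1 F (dF u)) ->
  (forall u : R, 0 <= u <= 1 -> p.[u] <= dF u) -> poly_integ p <= F 1 - F 0.
Proof.
move=> FdF pdF; pose P : {poly R} := \poly_(i < (size p).+1) (p`_i.-1 / i%:R).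
have dP : P^`() = p.
  apply/polyP => i; rewrite coef_deriv coef_poly ltnS /=.
  case: ltnP => h; last by rewrite mul0rn nth_default.
  by rewrite -[LHS]mulr_natr divfK // pnatr_eq0.
have P0 : P.[0] = 0 by rewrite horner_coef0 coef_poly /= invr0 mulr0.
have P1 : P.[1] = poly_integ p.
  rewrite horner_poly big_ord_recl /= invr0 mulr0 mul0r add0r.
  by apply: eq_bigr => i _; rewrite expr1n mulr1.
have dG (u : R) : 0 <= u <= 1 -> is_derive u 1 (F \- horner P) (dF u - p.[u]).
  by move=> /FdF h; rewrite -dP; apply: is_deriveB.
have [||c] := @MVT R (F \- horner P) (fun u => dF u - p.[u]) 0 1 ltr01.
- by move=> u; rewrite in_itv /= => /andP[/ltW u0 /ltW u1]; apply: dG; rewrite u0.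
- apply: derivable_within_continuous => u; rewrite in_itv /= => u01.
  exact: (@ex_derive _ _ _ _ _ _ _ (dG u u01)).
rewrite in_itv /= => /andP[/ltW c0 /ltW c1]; rewrite P0 P1 subr0 subr0 mulr1 => e.
rewrite -subr_ge0 -[leRHS]addrAC e subr_ge0 pdF ?c0 //.
Qed.

(* [gregory a b] is the integral over [u] in [0, 1] of
   [u (1 - u) ... (a - u) (1 + u) ... (b + u) / (a + b + 1)!], that is, of a
   multiple of the Beta integral of [t ^ (a - u) * (1 - t) ^ (b + u)]; whence
   total monotonicity. *)
Definition gregory_poly a b : {poly R} :=
  'X * \prod_(0 <= i < a) (i.+1%:R%:P - 'X) * \prod_(0 <= i < b) (i.+1%:R%:P + 'X).

(* [gregory j 0] is the absolute value of the Gregory coefficient of index [j.+1]. *)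
Definition gregory a b : R := poly_integ (gregory_poly a b) / (a + b).+1`!%:R.

Lemma gregory_polyE a b (u : R) : (gregory_poly a b).[u] =
  u * \prod_(0 <= i < a) (i.+1%:R - u) * \prod_(0 <= i < b) (i.+1%:R + u).
Proof.
by rewrite !hornerE !horner_prod; congr (_ * _ * _);
  apply: eq_bigr => i _; rewrite !hornerE.
Qed.

Lemma gregory_poly0E a (u : R) :
  (gregory_poly a 0).[u] = u * \prod_(0 <= i < a) (i.+1%:R - u).
Proof. by rewrite gregory_polyE [X in _ * X]big_geq // mulr1. Qed.

Lemma gregory_ge0 a b : 0 <= gregory a b.
Proof.
rewrite mulr_ge0 ?invr_ge0 //.
suff : poly_integ (-1 *: gregory_poly a b) <= 0.
  by rewrite poly_integZ mulN1r oppr_le0.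
rewrite -[leRHS](subrr (cst (0 : R) (0 : R))).
apply: (@poly_integ_le _ (cst (0 : R)) (cst 0)) => u /andP[u0 u1].
rewrite hornerZ gregory_polyE mulN1r oppr_le0 !mulr_ge0 //.
  by apply: prodr_ge0 => i _; rewrite subr_ge0 (le_trans u1) // ler1n.
by apply: prodr_ge0 => i _; rewrite addr_ge0.
Qed.

(** The two new factors add up to a constant: (a + 1 - u) + (b + 1 + u) = a + b + 2. *)
Lemma gregoryD a b : gregory a b = gregory a.+1 b + gregory a b.+1.
Proof.
have e : gregory_poly a.+1 b + gregory_poly a b.+1 = (a + b).+2%:R *: gregory_poly a b.
  rewrite /gregory_poly !big_nat_recr //= -mul_polyC.
  have -> : (a + b).+2%:R = a.+1%:R + b.+1%:R :> R by rewrite -natrD addSn addnS.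
  rewrite polyCD; ring.
rewrite /gregory addSn addnS -mulrDl -poly_integD e poly_integZ.
rewrite (factS (a + b).+1) (natrM _ (a + b).+2).
by rewrite invfM mulrACA divff ?mul1r // pnatr_eq0.
Qed.

Lemma gregory00 : gregory 0 0 <= 1.
Proof.
rewrite /gregory divr1.
rewrite -[leRHS](subr0 (id (1 : R))).
apply: (@poly_integ_le _ id (cst 1)) => u /andP[u0 u1].
by rewrite gregory_poly0E big_geq // mulr1.
Qed.

(** The integrands telescope to 1 - (1 - u)(2 - u)...(J - u) / J!, which is at most 1 on [0, 1]. *)
Lemma sum_gregory J : \sum_(0 <= j < J) gregory j 0 <= 1.
Proof.
have -> : \sum_(0 <= j < J) gregory j 0 =
    poly_integ (\sum_(0 <= j < J) j.+1`!%:R^-1 *: gregory_poly j 0).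
  rewrite poly_integ_sum; apply: eq_bigr => j _.
  by rewrite poly_integZ mulrC /gregory addn0.
rewrite -[leRHS](subr0 (id (1 : R))).
apply: (@poly_integ_le _ id (cst 1)) => u /andP[u0 u1].
have -> : (\sum_(0 <= j < J) j.+1`!%:R^-1 *: gregory_poly j 0).[u] =
    1 - (\prod_(0 <= i < J) (i.+1%:R - u)) / J`!%:R.
  elim: J => [|J IHJ]; first by rewrite !big_geq // horner0 fact0 divr1 subrr.
  rewrite !big_nat_recr //= hornerD IHJ hornerZ gregory_poly0E.
  rewrite (factS J) (natrM _ J.+1); have := fact_neq0 R J.
  have : J.+1%:R != 0 :> R by rewrite pnatr_eq0.
  by move: J.+1%:R J`!%:R => x y hx hy; field; rewrite ?hx ?hy.
rewrite gerBl mulr_ge0 ?invr_ge0 // prodr_ge0 // => i _.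
by rewrite subr_ge0 (le_trans u1) // ler1n.
Qed.

Lemma prod_le_fact J (u : R) : 0 <= u <= 1 ->
  0 <= \prod_(0 <= i < J) (i.+1%:R - u) <= J`!%:R.
Proof.
move=> /andP[u0 u1]; have h (i : nat) : 0 <= i.+1%:R - u.
  by rewrite subr_ge0 (le_trans u1) // ler1n.
rewrite prodr_ge0 //=.
elim: J => [|J IHJ]; first by rewrite big_geq.
rewrite big_nat_recr //= factS natrM mulrC ler_pM ?prodr_ge0 //.
by rewrite gerBl.
Qed.

(** The partial sums of an expansion of 1/(N+1) - 1/(N+1+u), with an explicit remainder. *)
Lemma sum_gregory_beta_horner N J (u : R) : 0 <= u ->
  (\sum_(0 <= j < J) (beta R N j.+1 / j.+1`!%:R) *: gregory_poly j 0).[u] =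
  N.+1%:R^-1 - (N.+1%:R + u)^-1
  - beta R N J / J`!%:R * (\prod_(0 <= i < J) (i.+1%:R - u)) * (u / (N.+1%:R + u)).
Proof.
move=> u0; have Nu : N.+1%:R + u != 0 by rewrite gt_eqF // ltr_wpDr.
elim: J => [|J IHJ].
  rewrite !big_geq // horner0 betaN0 fact0 divr1 mulr1.
  have : N.+1%:R != 0 :> R by rewrite pnatr_eq0.
  by move: N.+1%:R Nu => x h1 h2; field; rewrite h1 h2.
rewrite !big_nat_recr //= hornerD IHJ hornerZ gregory_poly0E /beta addnS.
rewrite (factS (N + J).+1) (natrM _ (N + J).+2).
have -> : (N + J).+2%:R = N.+1%:R + J.+1%:R :> R by rewrite -natrD addSn addnS.
have : N.+1%:R + J.+1%:R != 0 :> R by rewrite -natrD pnatr_eq0.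
rewrite (factS J) (natrM _ J.+1).
have := fact_neq0 R (N + J).+1; have := fact_neq0 R J.
have : J.+1%:R != 0 :> R by rewrite pnatr_eq0.
have : N.+1%:R != 0 :> R by rewrite pnatr_eq0.
move: Nu; move: N.+1%:R J.+1%:R (N + J).+1`!%:R J`!%:R N`!%:R => x y z t w.
move: (\prod_(_ <= _ < _) _) => v h1 h2 h3 h4 h5 h6.
by field; rewrite h1 h2 h3 h4 h5 h6.
Qed.

Lemma is_derive_ln_shift N (u : R) : 0 <= u ->
  is_derive u 1 (fun v : R => ln (N.+1%:R + v)) (N.+1%:R + u)^-1.
Proof.
move=> u0; have Nu : 0 < N.+1%:R + u by rewrite ltr_wpDr.
have h := is_derive1_ln Nu.
have h2 : is_derive u 1 (fun v : R => N.+1%:R + v) 1.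
  by apply: trigger_derive; rewrite add0r mulr1.
have := @is_derive1_comp _ (@ln R) (fun v => N.+1%:R + v) u _ _ h h2.
by rewrite mulr1.
Qed.

(** The preceding identity is integrated over u in [0, 1], its remainder lying in [0, 1/(J+1)]. The
    limit is the integral of x^N (1 - x) f. *)
Lemma sum_gregory_beta N J :
  `|\sum_(0 <= j < J) gregory j 0 * beta R N j.+1
    - (N.+1%:R^-1 - (ln N.+2%:R - ln N.+1%:R))| <= J.+1%:R^-1.
Proof.
pose p := \sum_(0 <= j < J) (beta R N j.+1 / j.+1`!%:R) *: gregory_poly j 0.
have -> : \sum_(0 <= j < J) gregory j 0 * beta R N j.+1 = poly_integ p.
  rewrite poly_integ_sum; apply: eq_bigr => j _.
  by rewrite poly_integZ /gregory addn0 mulrC mulrA mulrAC.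
have e1 : N.+1%:R + 1 = N.+2%:R :> R by rewrite natr1.
have rem (u : R) : 0 <= u <= 1 -> 0 <= beta R N J / J`!%:R
    * (\prod_(0 <= i < J) (i.+1%:R - u)) * (u / (N.+1%:R + u)) <= J.+1%:R^-1.
  move=> u01; have /andP[p0 p1] := prod_le_fact J u01.
  have /andP[u0 u1] := u01; have Nu : 0 < N.+1%:R + u by rewrite ltr_wpDr.
  have q0 : 0 <= u / (N.+1%:R + u) by rewrite divr_ge0 // ltW.
  have q1 : u / (N.+1%:R + u) <= 1 by rewrite ler_pdivrMr // mul1r lerDr ler0n.
  have b0 := beta_ge0 R N J.
  apply/andP; split; first by rewrite mulr_ge0 // mulr_ge0 // divr_ge0.
  apply: (@le_trans _ _ (beta R N J)); last by rewrite betaC beta_le.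
  rewrite -[leRHS]mulr1; apply: ler_pM => //.
    by rewrite mulr_ge0 // divr_ge0.
  rewrite mulrAC ler_pdivrMr ?ltr0n ?fact_gt0 //.
  by rewrite ler_wpM2l.
rewrite ler_norml; apply/andP; split.
  (* The lower bound compares -p with an [F] whose derivative includes the slack 1/(J+1); the upper
     bound below only drops the nonnegative remainder. *)
  pose F u : R := ln (N.+1%:R + u) + (J.+1%:R^-1 - N.+1%:R^-1) * u.
  have : poly_integ (-1 *: p) <= F 1 - F 0.
    apply: (@poly_integ_le _ _ (fun u => (N.+1%:R + u)^-1 + (J.+1%:R^-1 - N.+1%:R^-1))).
      move=> u /andP[u0 u1]; apply: is_deriveD; first exact: is_derive_ln_shift.
      by apply: trigger_derive; rewrite /GRing.scale /= mulr1.
    move=> u u01; have /andP[u0 u1] := u01.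
    rewrite hornerZ sum_gregory_beta_horner //; have := rem u u01.
    set r := _ * (u / _); move: r N.+1%:R^-1 J.+1%:R^-1 (N.+1%:R + u)^-1.
  by move=> r x y z /andP[r0 r1]; lra.
  rewrite poly_integZ /F e1 addr0 mulr0 mulr1 addr0.
  move: (ln N.+2%:R) (ln N.+1%:R) N.+1%:R^-1 J.+1%:R^-1 (poly_integ p).
  by move=> x y z t w; lra.
pose F u : R := N.+1%:R^-1 * u - ln (N.+1%:R + u).
have : poly_integ p <= F 1 - F 0.
  apply: (@poly_integ_le _ _ (fun u => N.+1%:R^-1 - (N.+1%:R + u)^-1)).
    move=> u /andP[u0 u1]; apply: is_deriveB; last exact: is_derive_ln_shift.
    by apply: trigger_derive; rewrite /GRing.scale /= mulr1.
  move=> u u01; have /andP[u0 u1] := u01.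
  rewrite sum_gregory_beta_horner //; have := rem u u01.
  set r := _ * (u / _); move: r N.+1%:R^-1 J.+1%:R^-1 (N.+1%:R + u)^-1.
  by move=> r x y z /andP[r0 r1]; lra.
rewrite /F e1 addr0 mulr0 mulr1 sub0r.
have : 0 <= J.+1%:R^-1 :> R by rewrite invr_ge0.
move: (ln N.+2%:R) (ln N.+1%:R) N.+1%:R^-1 J.+1%:R^-1 (poly_integ p).
by move=> x y z t w; lra.
Qed.

End PolyIntegral.

(** * Euler's constant and the remainder *)

Section EulerGamma.
Variable R : realType.
Implicit Types (n m a N J k : nat).

Lemma cvgn_harmonic_bound (u : R^nat) (l C : R) :
  (forall n, `|u n - l| <= C * n.+1%:R^-1) -> u @ \oo --> l.
Proof.
move=> h; have C0 : (fun n => C * harmonic n) @ \oo --> (0 : R).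
  by rewrite -[X in _ --> X](mulr0 C); apply: cvgMr; apply: cvg_harmonic.
apply/cvgrPdist_le => e e0.
apply: filterS (cvgr_dist_le _ _ C0 e e0) => n /=.
rewrite sub0r normrN distrC => Ce; apply: le_trans (h n) _.
exact: le_trans (ler_norm _) Ce.
Qed.

Definition gregory_beta_sum N J : R := \sum_(0 <= j < J) gregory R j 0 * beta R N j.

(** This stands for the integral of x^N f over [0, 1]. *)
Definition gregory_series N : R := limn (gregory_beta_sum N).

Lemma gregory_beta_sum_le N J : 0 <= gregory_beta_sum N J <= N.+1%:R^-1.
Proof.
apply/andP; split.
  by apply: sumr_ge0 => j _; rewrite mulr_ge0 ?gregory_ge0 ?beta_ge0.
apply: (@le_trans _ _ ((\sum_(0 <= j < J) gregory R j 0) * N.+1%:R^-1)).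
  rewrite big_distrl; apply: ler_sum => j _ /=.
  by rewrite ler_wpM2l ?gregory_ge0 ?beta_le.
by rewrite -[leRHS]mul1r ler_wpM2r ?invr_ge0 ?sum_gregory.
Qed.

Lemma cvg_gregory_beta_sum N : gregory_beta_sum N @ \oo --> gregory_series N.
Proof.
apply: nondecreasing_is_cvgn.
  apply/nondecreasing_seqP => J; rewrite /gregory_beta_sum big_nat_recr //=.
  by rewrite lerDl mulr_ge0 ?gregory_ge0 ?beta_ge0.
by exists N.+1%:R^-1 => _ [J _ <-]; have /andP[] := gregory_beta_sum_le N J.
Qed.

Lemma gregory_series_le N : 0 <= gregory_series N <= N.+1%:R^-1.
Proof.
have cs := @cvg_gregory_beta_sum N.
apply/andP; split; [apply: (cvgr_to_ge cs)|apply: (cvgr_to_le cs)];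
  by apply: nearW => J; have /andP[] := gregory_beta_sum_le N J.
Qed.

Lemma gregory_seriesS N : gregory_series N - gregory_series N.+1 =
  N.+1%:R^-1 - (ln N.+2%:R - ln N.+1%:R).
Proof.
have h1 := cvgB (@cvg_gregory_beta_sum N) (@cvg_gregory_beta_sum N.+1).
rewrite -(cvg_lim (@norm_hausdorff _ R) (h1 _)); apply: cvg_lim => //.
apply: (@cvgn_harmonic_bound _ _ 1) => J; rewrite mul1r.
have := sum_gregory_beta R N J; congr (`|_ - _| <= _).
rewrite -[RHS]sumrB; apply: eq_bigr => j _.
by rewrite [beta R N j]betaD; ring.
Qed.

Lemma harmonic_sub_ln N :
  harmonic_number R N - ln N.+1%:R = gregory_series 0 - gregory_series N.
Proof.
elim: N => [|N IHN].
  by rewrite /harmonic_number big_geq // ln1 !subrr.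
rewrite harmonic_numberS; have := gregory_seriesS N.
move: (gregory_series _) (gregory_series _) (gregory_series _) IHN.
move=> x y z; move: (ln _) (ln _) (harmonic_number R N) N.+1%:R^-1.
move=> p q r t; lra.
Qed.

Lemma euler_gammaE : euler_gamma R = gregory_series 0.
Proof.
apply: cvg_lim; first exact: norm_hausdorff.
(* The shift is needed because [harmonic_sub_ln] pairs H_n with ln (n + 1). The extra term 1/(n+1)
   and [gregory_series n] are each at most 1/(n+1), hence the constant 2. *)
rewrite -(cvg_shiftn 1); apply: (@cvgn_harmonic_bound _ _ 2) => n /=.
rewrite addn1 -/(harmonic_number R n.+1) harmonic_numberS.
have := harmonic_sub_ln n.
have := gregory_series_le n.
have : 0 <= n.+1%:R^-1 :> R by rewrite invr_ge0.
move: (gregory_series _) (gregory_series _) (harmonic_number _ _) (ln _) n.+1%:R^-1.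
move=> x y z t w w0 /andP[h1 h2] h3; rewrite ler_norml.
apply/andP; split; lra.
Qed.

Lemma ln_harmonic N :
  ln N.+1%:R = harmonic_number R N - euler_gamma R + gregory_series N.
Proof.
rewrite euler_gammaE; have := harmonic_sub_ln N.
move: (gregory_series _) (gregory_series _) (harmonic_number _ _) (ln _) => x y z t.
lra.
Qed.

(** The integral V of x^a P_n f, used with [a = n - m]. *)
Definition legendre_remainder n a : R :=
  \sum_(0 <= k < n.+1) legendre_coef R n k * gregory_series (a + k).

Lemma cvg_legendre_sum n a :
  legendre_sum (gregory R) n a 0 @ \oo --> legendre_remainder n a.
Proof.
have -> : legendre_sum (gregory R) n a 0 = fun J =>
    \sum_(0 <= k < n.+1) legendre_coef R n k * gregory_beta_sum (a + k) J.
  apply/funext => J; rewrite /legendre_sum.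
  under eq_bigr do rewrite addn0 /legendre_beta big_distrr /=.
  rewrite exchange_big /=; apply: eq_bigr => k _.
  by rewrite big_distrr /=; apply: eq_bigr => j _; ring.
rewrite /legendre_remainder; elim: n.+1 (legendre_coef R n) => [|K IHK] c.
  rewrite big_geq //; under eq_fun do rewrite big_geq //; exact: cvg_cst.
rewrite big_nat_recr //=; under eq_fun do rewrite big_nat_recr //=.
by apply: cvgD; [exact: IHK|apply: cvgMr; exact: cvg_gregory_beta_sum].
Qed.

Lemma legendre_remainder_bounds n a : (0 < a <= n)%N ->
  0 <= (-1) ^+ (n + a) * legendre_remainder n a <= 2 / 4 ^+ a.
Proof.
move=> an; pose S : R := \sum_(0 <= k < n.+1) `|legendre_coef R n k|.
pose C (J : nat) : R := a%:R * (S * harmonic J).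
have h J : - C J <= (-1) ^+ (n + a) * legendre_sum (gregory R) n a 0 J
    <= 2 / 4 ^+ a + C J.
  exact: (legendre_sum_bounds (@gregory_ge0 R) (@gregoryD R) (gregory00 R) J an).
have C0 : C @ \oo --> (0 : R).
  rewrite -[X in _ --> X](mulr0 a%:R); apply: cvgMr.
  by rewrite -[X in _ --> X](mulr0 S); apply: cvgMr; apply: cvg_harmonic.
have cl : (fun J => (-1) ^+ (n + a) * legendre_sum (gregory R) n a 0 J) @ \oo -->
    (-1) ^+ (n + a) * legendre_remainder n a by apply: cvgMr; apply: cvg_legendre_sum.
apply/andP; split.
  have NC : (fun J => - C J) @ \oo --> - (0 : R) by apply: cvgN.
  rewrite -oppr0; apply: (ler_cvg_to NC cl).
  by apply: nearW => J; have /andP[] := h J.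
rewrite -[leRHS]addr0.
have c2 : (fun J => 2 / 4 ^+ a + C J) @ \oo --> (2 / 4 ^+ a + 0 : R).
  by apply: cvgD => //; apply: cvg_cst.
apply: (ler_cvg_to cl c2).
by apply: nearW => J; have /andP[] := h J.
Qed.

Lemma LnmE n m : (m <= n)%N -> Lnm R n m =
  \sum_(0 <= k < n.+1) legendre_coef R n k * harmonic_number R k
  - euler_gamma R + legendre_remainder n (n - m).
Proof.
move=> mn; rewrite -(@legendre_harmonic R n (n - m)) ?leq_subr //.
rewrite -[euler_gamma R]mul1r -(sum_legendre_coef1 R n) big_distrl /= -sumrB.
rewrite -big_split; apply: eq_bigr => k _ /=.
by rewrite addn1 ln_harmonic /legendre_coef; ring.
Qed.

(** * Integrality and geometric growth for the least common multiple *)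

Lemma lcm_upto_harmonic_int n :
  (lcm_upto n)%:R * \sum_(0 <= k < n.+1) legendre_coef R n k * harmonic_number R k
  \is a Num.int.
Proof.
rewrite big_distrr /= big_nat_cond; apply: rpred_sum => k /andP[/andP[_ kn] _].
rewrite mulrCA rpredM //.
  by rewrite /legendre_coef rpredM ?rpredX ?rpredN ?rpredM ?rpred_nat ?rpred1.
rewrite big_distrr /= big_nat_cond; apply: rpred_sum => i /andP[/andP[i0 ik] _].
have /dvdnP[d ->] : (i %| lcm_upto n)%N by rewrite dvdn_lcm_upto // i0; lia.
by rewrite natrM mulfK ?rpred_nat // pnatr_eq0; lia.
Qed.

(** With t = ln q, exp (N t) >= (N t)^(k+1) / (k+1)!, which exceeds N^k once N t^(k+1) >= (k+1)!. *)
Lemma natr_expn_le_geom k (q : R) : 1 < q ->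
  exists N0, forall N, (N0 <= N)%N -> N%:R ^+ k <= q ^+ N.
Proof.
move=> q1; have t0 := ln_gt0 q1; set t := ln q in t0.
exists (Num.trunc (k.+1`!%:R / t ^+ k.+1)).+1 => N hN.
have [->|N0] := posnP N; first by case: k {hN} => [|k]; rewrite ?expr0 // expr0n.
have q0 : 0 < q by apply: lt_trans q1.
rewrite -[q](@lnK R) ?posrE // -/t -expRM_natl.
have Nt0 : 0 <= N%:R * t by rewrite mulr_ge0 // ltW.
apply: le_trans (expR_ge1Dxn k Nt0).
apply: (@le_trans _ _ ((N%:R * t) ^+ k.+1 / k.+1`!%:R)); last by rewrite lerDr.
rewrite ler_pdivlMr ?ltr0n ?fact_gt0 // exprMn [N%:R ^+ k.+1]exprSr -mulrA.
apply: ler_wpM2l; first exact: exprn_ge0.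
rewrite -ler_pdivrMr ?exprn_gt0 //.
apply: le_trans (_ : (Num.trunc (k.+1`!%:R / t ^+ k.+1)).+1%:R <= _); last by rewrite ler_nat.
exact/ltW/truncnS_gt.
Qed.

(** Strong induction through [lcm_upto_rec] closes once n^12 432^n <= (7/2)^(5n), which holds for
    large n as (7/2)^5 > 432; [C] dominates the finitely many smaller cases. Any base below 4 would
    suffice against 4^(m-n). *)
Lemma lcm_upto_le_geom : exists C : R, forall n, (lcm_upto n)%:R <= C * (7 / 2) ^+ n.
Proof.
have q1 : 1 < (7 / 2) ^+ 5 / 432 :> R by lra.
have [N0 hN0] := natr_expn_le_geom 12 q1.
pose C : R := 1 + \sum_(0 <= i < N0.+1) (lcm_upto i)%:R.
have C0 : 0 <= C by rewrite addr_ge0 // sumr_ge0.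
have base n : (n <= N0)%N -> (lcm_upto n)%:R <= C.
  rewrite -ltnS => nN; rewrite /C big_mkord (bigD1 (Ordinal nN)) //= addrCA lerDl.
  by rewrite addr_ge0 // sumr_ge0.
exists C; elim/ltn_ind => n IHn.
have [nN|Nn] := leqP n N0.
  rewrite (le_trans (base n nN)) // ler_peMr // exprn_ege1 //; lra.
have n0 : (0 < n)%N by lia.
have := lcm_upto_rec n0; rewrite -(ler_nat R) (natrM _ (_ * _)) natrM !natrX => h.
have p0 : 0 <= C * (7 / 2) ^+ n by rewrite mulr_ge0 // exprn_ge0 //; lra.
rewrite -(@ler_pXn2r _ 6) ?nnegrE //; apply: le_trans h _.
have h6 : (lcm_upto (n %/ 6))%:R ^+ 6 <= C ^+ 6 * (7 / 2) ^+ n.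
  apply: (@le_trans _ _ ((C * (7 / 2) ^+ (n %/ 6)) ^+ 6)).
    rewrite lerXn2r ?nnegrE ?mulr_ge0 ?exprn_ge0 //; try lra.
    by apply: IHn; rewrite ltn_Pdiv.
  rewrite exprMn -exprM ler_wpM2l ?exprn_ge0 // ler_weXn2l ?leq_trunc_div //; lra.
have hn := hN0 n (ltnW Nn).
have w0 : 0 < 432%:R :> R by rewrite ltr0n.
move: p0 h6 hn w0; set k : R := 7 / 2; move: (432%:R : R) => w p0 h6 hn w0.
apply: (@le_trans _ _ ((k ^+ 5 / w) ^+ n * w ^+ n * (C ^+ 6 * k ^+ n))).
  apply: ler_pM h6; first by rewrite mulr_ge0 ?exprn_ge0 // ltW.
    by rewrite exprn_ge0.
  by apply: ler_wpM2r hn; rewrite exprn_ge0 // ltW.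
rewrite -exprMn divfK ?gt_eqF // [(C * _) ^+ 6]exprMn mulrCA ler_wpM2l ?exprn_ge0 //.
by rewrite exprAC -exprSr.
Qed.

End EulerGamma.

(** * Fractional parts and the irrationality criterion *)

Lemma frac_partD_int (R : realType) (x y : R) :
  x \is a Num.int -> 0 <= y < 1 -> frac_part (x + y) = y.
Proof.
move=> /intrP[z ->] /andP[y0 y1].
rewrite /frac_part (@floor_def _ _ z); first by rewrite addrC addKr.
by rewrite lerDl y0 intrD ltrD2l.
Qed.

(* A sequence indexed by n >= maxn 1 m is written over j : nat with
   n = maxn 1 m + j. *)
Theorem mainTheorem1 (R : realType) (m : nat)
  (hm : ~ ((fun j : nat =>
              let n := (maxn 1 m + j)%N in
              frac_part ((lcm_upto n)%:R * (-1) ^+ m * Lnm R n m))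
             @ \oo --> (0 : R))) :
  @irrational R (euler_gamma R).
Proof.
move=> /rationalP[p [q gammaE]]; apply: hm.
have [C hC] := lcm_upto_le_geom R.
(* Chosen so that C (7/2)^n times 2 / 4^(n-m) equals K (7/8)^n, which is at most K (7/8)^j since j
   <= n. *)
pose K : R := C * 2 * 4 ^+ m.
have geom0 : (fun j => K * (7 / 8) ^+ j) @ \oo --> (0 : R).
  rewrite -[X in _ --> X](mulr0 K); apply: cvgMr; apply: cvg_expr.
  by rewrite ger0_norm; lra.
have small d : 0 < d -> \forall j \near \oo, K * (7 / 8) ^+ j <= d.
  move=> d0; apply: filterS (cvgr_dist_le _ _ geom0 d d0) => i.
  by rewrite sub0r normrN; apply: le_trans (ler_norm _).
apply/cvgrPdist_le => e e0.
have half_gt0 : 0 < 2^-1 :> R by rewrite invr_gt0.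
(* The bound 1/2 keeps the nonnegative part below 1, so that it is the fractional part; [q < j]
   makes [q], when positive, divide [lcm_upto n]. *)
apply: filterS3 (small e e0) (small _ half_gt0) (nbhs_infty_gt q) => j Ke K2 qj.
set n := (maxn 1 m + j)%N => /=.
have mn : (m < n)%N by rewrite /n; lia.
have qn : (q <= n)%N by rewrite /n; lia.
have an : (0 < n - m <= n)%N by rewrite subn_gt0 mn leq_subr.
have := legendre_remainder_bounds R an.
set v := (-1) ^+ (n + (n - m)) * _ => /andP[v0 vle].
have C0 : 0 <= C.
  by have := hC 0; rewrite expr0 mulr1; apply: le_trans.
have dv0 : 0 <= (lcm_upto n)%:R * v by rewrite mulr_ge0.
have dvK : (lcm_upto n)%:R * v <= K * (7 / 8) ^+ j.
  apply: (@le_trans _ _ (C * (7 / 2) ^+ n * (2 / 4 ^+ (n - m)))).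
    by apply: ler_pM.
  have -> : C * (7 / 2) ^+ n * (2 / 4 ^+ (n - m)) = K * (7 / 8) ^+ n.
    have f4 : 4 ^+ (n - m) != 0 :> R by rewrite expf_neq0.
    have -> : (7 / 2) ^+ n = (7 / 8) ^+ n * (4 ^+ (n - m) * 4 ^+ m) :> R.
      rewrite -exprD subnK ?(ltnW mn) // -exprMn; congr (_ ^+ _); lra.
    by rewrite /K; field.
  rewrite ler_wpM2l ?mulr_ge0 ?exprn_ge0 // ler_wiXn2l ?leq_addl //; lra.
have -> : (lcm_upto n)%:R * (-1) ^+ m * Lnm R n m =
    (-1) ^+ m * ((lcm_upto n)%:R * \sum_(0 <= k < n.+1)
      legendre_coef R n k * harmonic_number R k - (lcm_upto n)%:R * euler_gamma R)
    + (lcm_upto n)%:R * v.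
  rewrite LnmE ?(ltnW mn) // /v.
  (* Parity turns the sign in [v] into (-1)^m. *)
  have -> : (n + (n - m) = (n - m) * 2 + m)%N by lia.
  by rewrite exprD exprM sqrr_sign mul1r; ring.
rewrite frac_partD_int; first last.
- by rewrite dv0 (le_lt_trans (le_trans dvK K2)) //; lra.
- rewrite rpredM ?rpredX ?rpredN ?rpred1 // rpredB ?lcm_upto_harmonic_int //.
  (* For [q = 0] the quotient is 0 by the convention on inverses, hence integral. *)
  rewrite gammaE; case: (posnP q) => [->|q0]; first by rewrite invr0 !mulr0 rpred0.
  have /dvdnP[d ->] : (q %| lcm_upto n)%N by rewrite dvdn_lcm_upto ?q0.
  rewrite natrM mulrCA mulfK ?pnatr_eq0 -?lt0n //.
  by rewrite rpredM ?rpred_nat ?rpred_int.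
by rewrite sub0r normrN ger0_norm // (le_trans dvK).
Qed.
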